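(* Let $R$ be a Bézout domain, $W\in R\setminus\{0\}$, let $v_1,v_2$ be divisors of $W$, and let $e_1=e_{v_1}$, $e_2=e_{v_2}$ be the corresponding elementary factorizations of $W$. Let $a$ be a gcd of $v_1$ and $v_2$, and put $b=v_1/a$, $c=v_2/a$, $d=W/(abc)$; let $s$ be a gcd of $a$ and $d$, and put $a'=a/s$, $d'=d/s$. Then: 1. $e_1$ and $e_2$ are isomorphic in $\mathrm{hef}(R,W)$ if and only if $a',b,c,d'$ are pairwise coprime and $(bc,s)=(1)$. 2. An odd isomorphism between $e_1$ and $e_2$ in $\mathrm{HEF}(R,W)$ exists if and only if $a',b,c,d'$ are pairwise coprime and $(a'd',s)=(1)$.
   Context: A Bézout domain is an integral domain in which every finitely generated ideal is principal; in it gcds exist up to units, and $(x,y)=(1)$ means that $x$ and $y$ are coprime. (One has that $abc$ divides $W$, so $d\in R$.) For $W\in R\setminus\{0\}$, a matrix factorization of $W$ is a pair $a=(M,D)$ with $M=M^{\hat 0}\oplus M^{\hat 1}$ a free $\mathbb{Z}_2$-graded $R$-module of finite rank and $D$ an odd endomorphism with $D^2=W\,\mathrm{id}_M$. For $a_i=(M_i,D_i)$, the $\mathbb{Z}_2$-graded module $\mathrm{Hom}_R(M_1,M_2)$ carries the differential $\mathfrak{d}(f)=D_2\circ f-(-1)^{\kappa}f\circ D_1$ for $f$ of degree $\kappa$. $\mathrm{HMF}(R,W)$ has these objects and morphisms the total ($\mathbb{Z}_2$-graded) cohomology of this differential; $\mathrm{hmf}(R,W)$ keeps only the even cohomology. A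 matrix factorization is elementary if $M^{\hat 0}$ and $M^{\hat 1}$ have rank one; $\mathrm{HEF}(R,W)$ and $\mathrm{hef}(R,W)$ are the full subcategories of $\mathrm{HMF}(R,W)$ and $\mathrm{hmf}(R,W)$ on elementary factorizations. For a divisor $v$ of $W$, with $u=W/v$, $e_v=(R^{1|1},D_v)$ where $R^{1|1}=R\oplus R$ (even part first) and $D_v=\begin{pmatrix}0&v\\ u&0\end{pmatrix}$. *)

(* Defs.v *)
From HB Require Import structures.
From mathcomp Require Import all_boot all_order all_algebra.

Set Implicit Arguments.
Unset Strict Implicit.
Unset Printing Implicit Defensive.

Import GRing.Theory.
Local Open Scope ring_scope.

(* Categories whose hom-sets are setoids: [eqmor] is equality of morphisms. *)
Record category := Category {
  obj :> Type;
  mor : obj -> obj -> Type;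
  eqmor : forall x y, mor x y -> mor x y -> Prop;
  idmor : forall x, mor x x;
  compmor : forall x y z, mor y z -> mor x y -> mor x z;
  eqmor_refl : forall x y (f : mor x y), eqmor f f;
  eqmor_sym : forall x y (f g : mor x y), eqmor f g -> eqmor g f;
  eqmor_trans : forall x y (f g h : mor x y),
    eqmor f g -> eqmor g h -> eqmor f h;
  compmor_eq : forall x y z (g g' : mor y z) (f f' : mor x y),
    eqmor g g' -> eqmor f f' -> eqmor (compmor g f) (compmor g' f');
  compmorA : forall x y z t (h : mor z t) (g : mor y z) (f : mor x y),
    eqmor (compmor h (compmor g f)) (compmor (compmor h g) f);
  compmor1l : forall x y (f : mor x y), eqmor (compmor (idmor y) f) f;
  compmor1r : forall x y (f : mor x y), eqmor (compmor f (idmor x)) f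
}.

Arguments mor {c} x y.
Arguments eqmor {c x y} f g.
Arguments idmor {c} x.
Arguments compmor {c x y z} g f.

Definition is_iso (C : category) (x y : C) (f : mor x y) : Prop :=
  exists g : mor y x,
    eqmor (compmor g f) (idmor x) /\ eqmor (compmor f g) (idmor y).

Definition isomorphic (C : category) (x y : C) : Prop :=
  exists f : mor x y, is_iso f.

Definition full_subcategory (C : category) (P : C -> Prop) : category :=
  @Category {x : C | P x} (fun x y => mor (sval x) (sval y))
    (fun _ _ f g => eqmor f g) (fun x => idmor (sval x))
    (fun _ _ _ g f => compmor g f)
    (fun _ _ => @eqmor_refl C _ _) (fun _ _ => @eqmor_sym C _ _)
    (fun _ _ => @eqmor_trans C _ _) (fun _ _ _ => @compmor_eq C _ _ _)
    (fun _ _ _ _ => @compmorA C _ _ _ _)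
    (fun _ _ => @compmor1l C _ _) (fun _ _ => @compmor1r C _ _).

(* A [vectType] over a nontrivial ring is a module linearly isomorphic to     *)
(* some 'rV_n, that is, a free module of finite rank (its [dim]).  Degrees in *)
(* Z_2 are booleans, [false] being even, and addition of degrees is [(+)].    *)
Section Graded.
Variable R : comNzRingType.

Record gradedModule := GradedModule {
  even_part : vectType R;
  odd_part : vectType R
}.

Definition carrier (M : gradedModule) : vectType R :=
  (even_part M * odd_part M)%type.

Definition in_degree (M : gradedModule) (i : bool) (x : carrier M) : Prop :=
  if i then x.1 = 0 else x.2 = 0.

Definition homogeneous (M N : gradedModule) (k : bool)
    (f : 'Hom(carrier M, carrier N)) : Prop :=
  forall (i : bool) (x : carrier M), in_degree i x -> in_degree (i (+) k) (f x).

Definition proj_fun (M : gradedModule) (i : bool) (x : carrier M) : carrier M :=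
  if i then (0, x.2) else (x.1, 0).

Fact proj_fun_is_linear M i : linear (@proj_fun M i).
Proof.
by case: i => k [x0 x1] [y0 y1]; congr (_, _);
  rewrite /= ?scaler0 ?addr0.
Qed.

HB.instance Definition _ M i :=
  GRing.isLinear.Build R (carrier M) (carrier M) _ (@proj_fun M i)
    (@proj_fun_is_linear M i).

Definition proj (M : gradedModule) (i : bool) : 'End(carrier M) :=
  linfun (@proj_fun M i).

(* The component of degree [k] in Hom(M, N) = Hom^0(M, N) (+) Hom^1(M, N). *)
Definition component (M N : gradedModule) (k : bool)
    (f : 'Hom(carrier M, carrier N)) : 'Hom(carrier M, carrier N) :=
  \sum_(i : bool) (proj N (i (+) k) \o f \o proj M i)%VF.

Lemma projE M i x : proj M i x = proj_fun i x. Proof. by rewrite lfunE. Qed.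

Lemma componentE M N k (f : 'Hom(carrier M, carrier N)) x :
  component k f x = proj_fun k (f (proj_fun false x))
                    + proj_fun (~~ k) (f (proj_fun true x)).
Proof. by rewrite /component big_bool /= addrC add_lfunE !comp_lfunE !projE. Qed.

Lemma proj_sum M x : @proj_fun M false x + proj_fun true x = x.
Proof. by case: x => x0 x1; congr (_, _); rewrite /= ?addr0 ?add0r. Qed.

Lemma component_sum M N (f : 'Hom(carrier M, carrier N)) :
  component false f + component true f = f.
Proof.
apply/lfunP => x; rewrite add_lfunE !componentE /=.
by rewrite addrACA [X in _ + X]addrC !proj_sum -linearD proj_sum.
Qed.

Lemma component_homogeneous M N k (f : 'Hom(carrier M, carrier N)) :
  homogeneous k (component k f).
Proof.
move=> i [x0 x1]; rewrite componentE.
by case: i; case: k => /= ->; rewrite linear0 /= ?addr0.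
Qed.

Lemma in_degree_proj M i (x : carrier M) : in_degree i (proj_fun i x).
Proof. by case: i. Qed.

Lemma proj_in_degree M i j (x : carrier M) :
  in_degree i x -> proj_fun j x = if i == j then x else 0.
Proof. by case: x => x0 x1; case: i; case: j => /= ->. Qed.

Lemma component_of_homogeneous M N k l (f : 'Hom(carrier M, carrier N)) :
  homogeneous k f -> component l f = if k == l then f else 0.
Proof.
move=> fk; apply/lfunP => x; rewrite componentE.
rewrite !(proj_in_degree _ (fk _ _ (in_degree_proj _ _))).
case: k fk; case: l => fk /=; rewrite ?addr0 ?zero_lfunE //;
  by rewrite -linearD proj_sum.
Qed.

(* f^0 - f^1, that is, (-1)^k f on homogeneous f of degree k. *)
Definition signed (M N : gradedModule) (f : 'Hom(carrier M, carrier N)) :=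
  component false f - component true f.

Lemma signed_homogeneous M N k (f : 'Hom(carrier M, carrier N)) :
  homogeneous k f -> signed f = (-1) ^+ k *: f.
Proof.
move=> fk; rewrite /signed !(component_of_homogeneous _ fk).
by case: k fk => _ /=; rewrite ?sub0r ?subr0 ?scaleN1r ?scale1r.
Qed.

Definition parity (M : gradedModule) (x : carrier M) : carrier M :=
  (x.1, - x.2).

Lemma parityK M x : parity (@parity M x) = x.
Proof. by case: x => x0 x1; rewrite /parity opprK. Qed.

Lemma parityE M x : @parity M x = proj_fun false x - proj_fun true x.
Proof. by case: x => x0 x1; congr (_, _); rewrite /= ?subr0 ?sub0r. Qed.

Lemma signedE M N (f : 'Hom(carrier M, carrier N)) x :
  signed f x = parity (f (parity x)).
Proof.
rewrite add_lfunE opp_lfunE !componentE !parityE !linearB /=.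
by rewrite opprK opprD [X in _ = _ + X]addrC [RHS]addrACA [in RHS](addrC (- _)).
Qed.

Lemma signedK M N (f : 'Hom(carrier M, carrier N)) : signed (signed f) = f.
Proof. by apply/lfunP => x; rewrite !signedE !parityK. Qed.

Lemma signed_comp M N P (g : 'Hom(carrier N, carrier P))
    (f : 'Hom(carrier M, carrier N)) :
  signed (g \o f)%VF = (signed g \o signed f)%VF.
Proof. by apply/lfunP => x; rewrite !(comp_lfunE, signedE) parityK. Qed.

Lemma signedB M N (f g : 'Hom(carrier M, carrier N)) :
  signed (f - g) = signed f - signed g.
Proof.
apply/lfunP => x; rewrite !(add_lfunE, opp_lfunE, signedE).
by congr (_, _) => /=; rewrite opprD.
Qed.

Lemma homogeneous0 M N k : @homogeneous M N k 0.
Proof. by move=> i x _; rewrite zero_lfunE; case: (i (+) k). Qed.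

Lemma homogeneousB M N k (f g : 'Hom(carrier M, carrier N)) :
  homogeneous k f -> homogeneous k g -> homogeneous k (f - g).
Proof.
move=> fk gk i x xi; have := (fk i x xi, gk i x xi).
rewrite add_lfunE opp_lfunE /in_degree.
by case: (i (+) k) => -[/= -> ->]; rewrite subr0.
Qed.

Lemma homogeneous_id M : @homogeneous M M false \1%VF.
Proof. by move=> i x xi; rewrite id_lfunE addbF. Qed.

Lemma homogeneous_comp M N P k l (g : 'Hom(carrier N, carrier P))
    (f : 'Hom(carrier M, carrier N)) :
  homogeneous k g -> homogeneous l f -> homogeneous (l (+) k) (g \o f)%VF.
Proof. by move=> gk fl i x xi; rewrite comp_lfunE addbA; exact/gk/fl. Qed.

End Graded.

Section MatrixFactorizations.
Variables (R : comNzRingType) (W : R).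

Record matrix_factorization := MatrixFactorization {
  mf_mod : gradedModule R;
  mf_D : 'End(carrier mf_mod);
  mf_odd : homogeneous true mf_D;
  mf_sqr : (mf_D \o mf_D)%VF = W *: \1%VF
}.

Implicit Types a b c : matrix_factorization.

Definition Hom a b := 'Hom(carrier (mf_mod a), carrier (mf_mod b)).

(* The formula for homogeneous maps, extended by additivity to all of Hom; see *)
(* [mf_diff_homogeneous].                                                      *)
Definition mf_diff a b (f : Hom a b) : Hom a b :=
  \sum_(k : bool) ((mf_D b \o component k f)
                   - (-1) ^+ k *: (component k f \o mf_D a))%VF.

Lemma mf_diffE a b (f : Hom a b) :
  mf_diff f = ((mf_D b \o f) - (signed f \o mf_D a))%VF.
Proof.
have -> : (mf_D b \o f = (mf_D b \o component false f)
                          + (mf_D b \o component true f))%VF.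
  by rewrite -comp_lfunDr component_sum.
rewrite /mf_diff big_bool /= scaleN1r scale1r /signed.
rewrite comp_lfunDl comp_lfunNl opprB opprK.
by rewrite [LHS]addrC addrACA [- _ + _]addrC.
Qed.

Lemma mf_diff_homogeneous a b k (f : Hom a b) : homogeneous k f ->
  mf_diff f = ((mf_D b \o f) - (-1) ^+ k *: (f \o mf_D a))%VF.
Proof.
by move=> fk; rewrite mf_diffE (signed_homogeneous fk) comp_lfunZl.
Qed.

Lemma signed_D a : signed (mf_D a) = - mf_D a.
Proof. by rewrite (signed_homogeneous (@mf_odd a)) scaleN1r. Qed.

Lemma mf_diffB a b (f g : Hom a b) : mf_diff (f - g) = mf_diff f - mf_diff g.
Proof.
rewrite !mf_diffE signedB comp_lfunDr comp_lfunDl !comp_lfunNr !comp_lfunNl.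
by rewrite !opprD !opprK addrACA.
Qed.

Lemma mf_diff0 a b : mf_diff (0 : Hom a b) = 0.
Proof. by have := mf_diffB (0 : Hom a b) 0; rewrite subr0 subrr. Qed.

Lemma mf_diffN a b (f : Hom a b) : mf_diff (- f) = - mf_diff f.
Proof. by rewrite -[- f]sub0r mf_diffB mf_diff0 sub0r. Qed.

Lemma mf_diffD a b (f g : Hom a b) : mf_diff (f + g) = mf_diff f + mf_diff g.
Proof. by rewrite -[g in LHS]opprK mf_diffB mf_diffN opprK. Qed.

Lemma mf_diff_sqr a b (f : Hom a b) : mf_diff (mf_diff f) = 0.
Proof.
rewrite !mf_diffE signedB !signed_comp signedK !signed_D comp_lfunDr comp_lfunDl.
rewrite !comp_lfunNl !comp_lfunNr comp_lfunNl (comp_lfunA (mf_D b) (mf_D b)).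
rewrite mf_sqr -(comp_lfunA f) mf_sqr -comp_lfunZl -comp_lfunZr.
rewrite comp_lfun1l comp_lfun1r (comp_lfunA (mf_D b)) opprK opprD opprK.
by rewrite addrA subrK subrr.
Qed.

Lemma mf_diff_id a : mf_diff (\1%VF : Hom a a) = 0.
Proof.
rewrite (mf_diff_homogeneous (@homogeneous_id _ _)) scale1r.
by rewrite comp_lfun1l comp_lfun1r subrr.
Qed.

Lemma mf_diff_signed a b (f : Hom a b) :
  mf_diff (signed f : Hom a b) = - signed (mf_diff f).
Proof.
rewrite !mf_diffE signedB !signed_comp !signed_D signedK.
by rewrite comp_lfunNl comp_lfunNr opprD !opprK.
Qed.

Lemma mf_diff_comp a b c (g : Hom b c) (f : Hom a b) :
  mf_diff (g \o f : Hom a c)%VF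
  = ((mf_diff g \o f) + (signed g \o mf_diff f))%VF.
Proof.
rewrite !mf_diffE signed_comp; move: (signed g) (signed f) => sg sf.
rewrite !(comp_lfunDl, comp_lfunDr) !(comp_lfunNl, comp_lfunNr) !comp_lfunA.
by rewrite addrA subrK.
Qed.

Lemma mf_diff_comp_l a b c (g : Hom b c) (f : Hom a b) :
  mf_diff f = 0 -> mf_diff (g \o f : Hom a c)%VF = (mf_diff g \o f)%VF.
Proof. by move=> f0; rewrite mf_diff_comp f0 comp_lfun0r addr0. Qed.

Lemma mf_diff_comp_r a b c (g : Hom b c) (f : Hom a b) :
  mf_diff g = 0 ->
  mf_diff (signed g \o f : Hom a c)%VF = (g \o mf_diff f)%VF.
Proof.
move=> g0; rewrite mf_diff_comp signedK mf_diff_signed g0.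
rewrite (signed_homogeneous (@homogeneous0 _ _ _ false)) scaler0 oppr0.
by rewrite comp_lfun0l add0r.
Qed.

Section TotalCohomology.

Definition cocycle a b := {f : Hom a b | mf_diff f = 0}.

Definition cohomologous a b (f g : cocycle a b) : Prop :=
  exists h : Hom a b, sval f - sval g = mf_diff h.

Definition cocycle_id a : cocycle a a := exist _ (\1%VF : Hom a a) (mf_diff_id a).

Fact cocycle_comp_subproof a b c (g : cocycle b c) (f : cocycle a b) :
  mf_diff (sval g \o sval f : Hom a c)%VF = 0.
Proof. by rewrite mf_diff_comp_l ?(svalP f) // (svalP g) comp_lfun0l. Qed.

Definition cocycle_comp a b c (g : cocycle b c) (f : cocycle a b) : cocycle a c :=
  exist _ _ (cocycle_comp_subproof g f).

Fact cohomologous_refl a b (f : cocycle a b) : cohomologous f f.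
Proof. by exists 0; rewrite mf_diff0 subrr. Qed.

Fact cohomologous_sym a b (f g : cocycle a b) :
  cohomologous f g -> cohomologous g f.
Proof. by case=> h fg; exists (- h); rewrite mf_diffN -fg opprB. Qed.

Fact cohomologous_trans a b (f g h : cocycle a b) :
  cohomologous f g -> cohomologous g h -> cohomologous f h.
Proof.
by case=> h1 fg [h2 gh]; exists (h1 + h2); rewrite mf_diffD -fg -gh addrA subrK.
Qed.

Fact cohomologous_comp a b c (g g' : cocycle b c) (f f' : cocycle a b) :
  cohomologous g g' -> cohomologous f f' ->
  cohomologous (cocycle_comp g f) (cocycle_comp g' f').
Proof.
case=> h gg' [k ff'].
exists ((h \o sval f) + (signed (sval g') \o k) : Hom a c)%VF.
rewrite mf_diffD mf_diff_comp_l ?(svalP f) // mf_diff_comp_r ?(svalP g') //=.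
rewrite -gg' -ff' comp_lfunDl comp_lfunDr comp_lfunNl comp_lfunNr.
by rewrite addrA subrK.
Qed.

Fact cocycle_compA a b c e (h : cocycle c e) (g : cocycle b c) (f : cocycle a b) :
  cohomologous (cocycle_comp h (cocycle_comp g f))
               (cocycle_comp (cocycle_comp h g) f).
Proof. by exists 0; rewrite mf_diff0 /= comp_lfunA subrr. Qed.

Fact cocycle_comp1l a b (f : cocycle a b) :
  cohomologous (cocycle_comp (cocycle_id b) f) f.
Proof. by exists 0; rewrite mf_diff0 /= comp_lfun1l subrr. Qed.

Fact cocycle_comp1r a b (f : cocycle a b) :
  cohomologous (cocycle_comp f (cocycle_id a)) f.
Proof. by exists 0; rewrite mf_diff0 /= comp_lfun1r subrr. Qed.

Definition HMF : category :=
  Category cohomologous_refl cohomologous_sym cohomologous_trans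
    cohomologous_comp cocycle_compA cocycle_comp1l cocycle_comp1r.

(* The class of [f] lies in the odd cohomology. *)
Definition odd_class a b (f : cocycle a b) : Prop :=
  exists g : cocycle a b, homogeneous true (sval g) /\ cohomologous f g.

End TotalCohomology.

Section EvenCohomology.

Definition even_cocycle a b :=
  {f : Hom a b | homogeneous false f /\ mf_diff f = 0}.

Definition even_cohomologous a b (f g : even_cocycle a b) : Prop :=
  exists h : Hom a b, homogeneous true h /\ sval f - sval g = mf_diff h.

Definition even_cocycle_id a : even_cocycle a a :=
  exist _ (\1%VF : Hom a a) (conj (@homogeneous_id _ _) (mf_diff_id a)).

Fact even_cocycle_comp_subproof a b c (g : even_cocycle b c)
    (f : even_cocycle a b) :
  homogeneous false (sval g \o sval f : Hom a c)%VF
  /\ mf_diff (sval g \o sval f : Hom a c)%VF = 0.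
Proof.
case: f g => [f [f0 df]] [g [g0 dg]] /=; split.
  by have := homogeneous_comp g0 f0.
by rewrite mf_diff_comp_l // dg comp_lfun0l.
Qed.

Definition even_cocycle_comp a b c (g : even_cocycle b c) (f : even_cocycle a b) :
  even_cocycle a c := exist _ _ (even_cocycle_comp_subproof g f).

Fact even_cohomologous_refl a b (f : even_cocycle a b) : even_cohomologous f f.
Proof. by exists 0; split; [exact: homogeneous0 | rewrite mf_diff0 subrr]. Qed.

Fact even_cohomologous_sym a b (f g : even_cocycle a b) :
  even_cohomologous f g -> even_cohomologous g f.
Proof.
case=> h [h1 fg]; exists (0 - h).
split; first exact: homogeneousB (@homogeneous0 _ _ _ _) h1.
by rewrite mf_diffB mf_diff0 -fg sub0r opprB.
Qed.

Fact even_cohomologous_trans a b (f g h : even_cocycle a b) :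
  even_cohomologous f g -> even_cohomologous g h -> even_cohomologous f h.
Proof.
move=> [k [k1 fg]] /even_cohomologous_sym[l [l1 hg]]; exists (k - l).
split; first exact: homogeneousB k1 l1.
by rewrite mf_diffB -fg -hg opprB addrA subrK.
Qed.

Fact even_cohomologous_comp a b c (g g' : even_cocycle b c)
    (f f' : even_cocycle a b) :
  even_cohomologous g g' -> even_cohomologous f f' ->
  even_cohomologous (even_cocycle_comp g f) (even_cocycle_comp g' f').
Proof.
case: g g' f f' => [g [g0 dg]] [g' [g'0 dg']] [f [f0 df]] [f' [f'0 df']].
move=> [h [/= h1 gg']] [k [/= k1 ff']].
exists ((h \o f) - (- (g' \o k)) : Hom a c)%VF; split.
  apply: homogeneousB; first by have := homogeneous_comp h1 f0.
  have k'1 := homogeneousB (@homogeneous0 _ _ _ _) k1.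
  by have := homogeneous_comp g'0 k'1; rewrite sub0r comp_lfunNr.
have sg : signed g' = g' by rewrite (signed_homogeneous g'0) scale1r.
rewrite opprK mf_diffD mf_diff_comp_l // -[g' in mf_diff (g' \o k)%VF]sg.
rewrite mf_diff_comp_r // -gg' -ff' comp_lfunDl comp_lfunDr.
by rewrite comp_lfunNl comp_lfunNr addrA subrK.
Qed.

Fact even_cocycle_compA a b c e (h : even_cocycle c e) (g : even_cocycle b c)
    (f : even_cocycle a b) :
  even_cohomologous (even_cocycle_comp h (even_cocycle_comp g f))
                    (even_cocycle_comp (even_cocycle_comp h g) f).
Proof.
by exists 0; split; [exact: homogeneous0 | rewrite mf_diff0 /= comp_lfunA subrr].
Qed.

Fact even_cocycle_comp1l a b (f : even_cocycle a b) :
  even_cohomologous (even_cocycle_comp (even_cocycle_id b) f) f.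
Proof.
by exists 0; split; [exact: homogeneous0 | rewrite mf_diff0 /= comp_lfun1l subrr].
Qed.

Fact even_cocycle_comp1r a b (f : even_cocycle a b) :
  even_cohomologous (even_cocycle_comp f (even_cocycle_id a)) f.
Proof.
by exists 0; split; [exact: homogeneous0 | rewrite mf_diff0 /= comp_lfun1r subrr].
Qed.

Definition hmf : category :=
  Category even_cohomologous_refl even_cohomologous_sym even_cohomologous_trans
    even_cohomologous_comp even_cocycle_compA even_cocycle_comp1l
    even_cocycle_comp1r.

End EvenCohomology.

Definition elementary a : Prop :=
  dim (even_part (mf_mod a)) = 1%N /\ dim (odd_part (mf_mod a)) = 1%N.

Definition HEF : category := @full_subcategory HMF elementary.
Definition hef : category := @full_subcategory hmf elementary.

Definition odd_isomorphic (x y : HEF) : Prop :=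
  exists f : mor x y, odd_class f /\ is_iso f.

(* The factorization e_v, where the cofactor u = W / v is passed explicitly. *)
Section ElementaryFactorization.
Variables (v u : R).
Hypothesis vuW : W = v * u.

Let R11 := GradedModule (R^o : vectType R) (R^o : vectType R).

Definition e_fun (x : carrier R11) : carrier R11 := (v * x.2, u * x.1).

Fact e_fun_is_linear : linear e_fun.
Proof.
by move=> k [x0 x1] [y0 y1]; congr (_, _);
  rewrite /= mulrDr; congr (_ + _); exact: mulrCA.
Qed.

HB.instance Definition _ :=
  GRing.isLinear.Build R (carrier R11) (carrier R11) _ e_fun e_fun_is_linear.

Fact e_odd : @homogeneous R R11 R11 true (linfun e_fun).
Proof. by move=> i [x0 x1]; rewrite lfunE; case: i => /= ->; exact: mulr0. Qed.

Fact e_sqr : (linfun e_fun \o linfun e_fun)%VF = W *: \1%VF.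
Proof.
apply/lfunP => x.
rewrite comp_lfunE (lfunE e_fun) (lfunE e_fun) scale_lfunE id_lfunE vuW.
by case: x => x0 x1; congr (_, _); rewrite /= mulrA // [u * v]mulrC.
Qed.

Definition e_mf : matrix_factorization := MatrixFactorization e_odd e_sqr.

Fact e_elementary : elementary e_mf.
Proof. by []. Qed.

Definition e_HEF : HEF := exist _ (e_mf : HMF) e_elementary.
Definition e_hef : hef := exist _ (e_mf : hmf) e_elementary.

End ElementaryFactorization.

End MatrixFactorizations.

Arguments e_HEF {R W} v {u} vuW.
Arguments e_hef {R W} v {u} vuW.

Section Divisibility.
Variable R : idomainType.

(* Every ideal (x_0, ..., x_(n-1)) is equal to some principal ideal (g). *)
Definition bezout_domain : Prop :=
  forall (n : nat) (x : 'I_n -> R), exists g : R, forall y : R,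
    (exists c : 'I_n -> R, y = \sum_i c i * x i) <-> (exists r : R, y = r * g).

Definition divides (x y : R) : Prop := exists z, y = z * x.

Definition is_gcd (g x y : R) : Prop :=
  [/\ divides g x, divides g y
    & forall h, divides h x -> divides h y -> divides h g].

Definition are_coprime (x y : R) : Prop := is_gcd 1 x y.

Definition pairwise_coprime (s : seq R) : Prop :=
  forall i j : nat, (i < j < size s)%N -> are_coprime s`_i s`_j.

End Divisibility.

(* Main.v *)
Require Import Defs.
From HB Require Import structures.
From mathcomp Require Import all_boot all_order all_algebra.
From mathcomp Require Import ring.

Set Implicit Arguments.
Unset Strict Implicit.
Unset Printing Implicit Defensive.

Import GRing.Theory.
Local Open Scope ring_scope.

(** Every map between elementary factorizations is a 2 x 2 matrix over R, so an
isomorphism, its inverse and the homotopies that witness it are finitely many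
scalars subject to equations.  An even cocycle from e_1 to e_2 is diagonal, and
the cocycle equation [c * f1 = b * f0], with [b] and [c] coprime, forces it to
be [t] times diag(c, b); a cocycle going back is [t'] times diag(b, c).  Both
composites are multiplication by [t * t' * b * c], and boundaries act on the
diagonal by an element of the ideal (v_i, u_i).  Hence e_1 and e_2 are
isomorphic if and only if some multiple of [b * c] is 1 modulo (a b, c d) and
modulo (a c, b d).  This makes [b] comaximal to [a], [c] and [d], and likewise
[c].  Conversely, pairwise coprimality of [a'], [b], [c], [d'] makes both of
these ideals equal to (s), so that an inverse of [b * c] modulo [s] suffices.
This is [inverse_data_comaximal].

The odd case is the even one in disguise.  Up to a sign, an odd map into
e_(v_2) is an even map into the shifted factorization e_(u_2), so an odd
isomorphism from e_1 to e_2 amounts to an even one from e_(v_1) to e_(u_2).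
Since v_1 = (s b) a' and u_2 = (s b) d' with [a'] and [d'] coprime, passing to
the shift exchanges the roles of (a', d') and (b, c) and keeps [s].  The even
criterion therefore applies again, and its condition that [b * c] be coprime to
[s] becomes the condition that [a' * d'] be coprime to [s].

All of this uses coprimality in the form 1 = p x + q y, which is where the
Bezout property enters ([are_coprimeP]). *)

(** * Endomorphisms of the free module of rank 1|1 as matrices *)

Section RankOneOne.
Variable R : comNzRingType.

Definition free11 : gradedModule R :=
  GradedModule (R^o : vectType R) (R^o : vectType R).

Definition mx2_fun (p q r t : R) (x : carrier free11) : carrier free11 :=
  (p * x.1 + q * x.2, r * x.1 + t * x.2).

Fact mx2_fun_is_linear p q r t : linear (mx2_fun p q r t).
Proof. move=> k [x0 x1] [y0 y1].
by congr (_, _); rewrite /= /GRing.scale /=; ring. Qed.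

HB.instance Definition _ p q r t :=
  GRing.isLinear.Build R (carrier free11) (carrier free11) _ (mx2_fun p q r t)
    (mx2_fun_is_linear p q r t).

Definition mx2 p q r t : 'End(carrier free11) := linfun (mx2_fun p q r t).

Lemma mx2E p q r t x :
  mx2 p q r t x = (p * x.1 + q * x.2, r * x.1 + t * x.2).
Proof. by rewrite lfunE. Qed.

Lemma mx2_surj (f : 'End(carrier free11)) : exists p q r t, f = mx2 p q r t.
Proof.
pose e0 : carrier free11 := ((1 : R), (0 : R)).
pose e1 : carrier free11 := ((0 : R), (1 : R)).
exists (f e0).1, (f e1).1, (f e0).2, (f e1).2; apply/lfunP => x.
have -> : x = x.1 *: e0 + x.2 *: e1.
  by case: x => x0 x1; congr (_, _); rewrite /= /GRing.scale /=; ring.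
rewrite linearD !linearZ /= mx2E.
by congr (_, _); rewrite /= /GRing.scale /=; ring.
Qed.

Lemma mx2_inj p q r t p' q' r' t' : mx2 p q r t = mx2 p' q' r' t' ->
  [/\ p = p', q = q', r = r' & t = t'].
Proof.
move=> /lfunP E.
have := E ((1 : R), (0 : R)); have := E ((0 : R), (1 : R)); rewrite !mx2E /=.
by rewrite !mulr1 !mulr0 !add0r !addr0 => -[-> ->] [-> ->].
Qed.

Lemma mx2_0 : 0 = mx2 0 0 0 0.
Proof.
by apply/lfunP => x; rewrite zero_lfunE mx2E !mul0r addr0.
Qed.

Lemma mx2_1 : \1%VF = mx2 1 0 0 1.
Proof.
by apply/lfunP => -[x0 x1]; rewrite id_lfunE mx2E !mul0r !mul1r addr0 add0r.
Qed.

Lemma mx2B p q r t p' q' r' t' :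
  mx2 p q r t - mx2 p' q' r' t' = mx2 (p - p') (q - q') (r - r') (t - t').
Proof.
apply/lfunP => x; rewrite add_lfunE opp_lfunE !mx2E.
by congr (_, _); rewrite /=; ring.
Qed.

Lemma mx2M p q r t p' q' r' t' :
  (mx2 p q r t \o mx2 p' q' r' t')%VF =
  mx2 (p * p' + q * r') (p * q' + q * t') (r * p' + t * r') (r * q' + t * t').
Proof.
apply/lfunP => x; rewrite comp_lfunE !mx2E.
by congr (_, _); rewrite /=; ring.
Qed.

Lemma signed_mx2 p q r t : signed (mx2 p q r t) = mx2 p (- q) (- r) t.
Proof.
apply/lfunP => x; rewrite signedE !mx2E /parity.
by congr (_, _); rewrite /=; ring.
Qed.

Lemma homogeneous_mx2 k p q r t : homogeneous k (mx2 p q r t) <->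
  if k then p = 0 /\ t = 0 else q = 0 /\ r = 0.
Proof.
split=> [hk | ].
  have := hk false ((1 : R), (0 : R)) erefl.
  have := hk true ((0 : R), (1 : R)) erefl.
  rewrite !mx2E /= !mulr1 !mulr0 !add0r !addr0.
  by case: k {hk} => /= -> ->.
move=> E i [x0 x1]; rewrite mx2E /in_degree.
by case: i; case: k E => -[-> ->] /= ->; rewrite mulr0 mul0r addr0.
Qed.

Section Differential.
Variables (W v1 u1 v2 u2 : R) (W_v1 : W = v1 * u1) (W_v2 : W = v2 * u2).

Lemma mx2_e_mf v u (Wvu : W = v * u) : mf_D (e_mf Wvu) = mx2 0 v u 0.
Proof.
apply/lfunP => x; rewrite mx2E /= lfunE /= /e_fun.
by congr (_, _); rewrite /=; ring.
Qed.

Lemma mf_diff_mx2 p q r t :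
  mf_diff (mx2 p q r t : Defs.Hom (e_mf W_v1) (e_mf W_v2)) =
  mx2 (v2 * r + u1 * q) (v2 * t - v1 * p) (u2 * p - u1 * t) (u2 * q + v1 * r).
Proof.
rewrite mf_diffE !mx2_e_mf signed_mx2 !mx2M mx2B.
by congr mx2; ring.
Qed.

End Differential.

End RankOneOne.

(** * Isomorphisms in terms of scalars *)

Section IsomorphismCriteria.
Variable R : comNzRingType.

(** An isomorphism diag(f0, f1) from e_(v1) to e_(v2) in even cohomology with
inverse diag(g0, g1): the first two clauses are the cocycle equations, and [h]
and [k] are the entries of an odd homotopy, whose boundary has the same entry
[v * h + u * k] in both degrees. *)
Definition inverse_data (v1 u1 v2 u2 : R) : Prop :=
  exists f0 f1 g0 g1 : R,
    [/\ v2 * f1 = v1 * f0 /\ u2 * f0 = u1 * f1,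
        v1 * g1 = v2 * g0 /\ u1 * g0 = u2 * g1,
        exists h k, g0 * f0 - 1 = v1 * h + u1 * k
                 /\ g1 * f1 - 1 = v1 * h + u1 * k
      & exists h k, f0 * g0 - 1 = v2 * h + u2 * k
                 /\ f1 * g1 - 1 = v2 * h + u2 * k].

Variables (W v1 u1 v2 u2 : R) (W_v1 : W = v1 * u1) (W_v2 : W = v2 * u2).

Lemma isomorphic_hefP :
  isomorphic (e_hef v1 W_v1) (e_hef v2 W_v2) <-> inverse_data v1 u1 v2 u2.
Proof.
split.
  move=> [[f [f0 df]] [[g [g0 dg]] /= [[h [/= _ gf]] [k [/= _ fg]]]]].
  move: f f0 df g g0 dg h gf k fg => f.
  have [p [q [r [t ->]]]] := mx2_surj f => /homogeneous_mx2[-> ->] df g.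
  have [p' [q' [r' [t' ->]]]] := mx2_surj g => /homogeneous_mx2[-> ->] dg h.
  have [h00 [h01 [h10 [h11 ->]]]] := mx2_surj h => gf k.
  have [k00 [k01 [k10 [k11 ->]]]] := mx2_surj k => fg.
  move: df; rewrite mf_diff_mx2 mx2_0 => /mx2_inj[_ /subr0_eq ? /subr0_eq ? _].
  move: dg; rewrite mf_diff_mx2 mx2_0 => /mx2_inj[_ /subr0_eq ? /subr0_eq ? _].
  move: gf; rewrite mf_diff_mx2 mx2_1 mx2M mx2B !(mul0r, mulr0, addr0, add0r).
  move=> /mx2_inj[gf0 _ _ gf1].
  move: fg; rewrite mf_diff_mx2 mx2_1 mx2M mx2B !(mul0r, mulr0, addr0, add0r).
  move=> /mx2_inj[fg0 _ _ fg1].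
  exists p, t, p', t'; split=> //.
    by exists h10, h01; split; last rewrite gf1 addrC.
  by exists k10, k01; split; last rewrite fg1 addrC.
move=> [p [t [p' [t' [[f1 f2] [g1 g2] [h [h' [gf0 gf1]]] [k [k' [fg0 fg1]]]]]]]].
have Ef : homogeneous false (mx2 p 0 0 t) /\
    mf_diff (mx2 p 0 0 t : Defs.Hom (e_mf W_v1) (e_mf W_v2)) = 0.
  split; first by apply/homogeneous_mx2.
  by rewrite mf_diff_mx2 mx2_0 f1 f2 !mulr0 !addr0 !subrr.
have Eg : homogeneous false (mx2 p' 0 0 t') /\
    mf_diff (mx2 p' 0 0 t' : Defs.Hom (e_mf W_v2) (e_mf W_v1)) = 0.
  split; first by apply/homogeneous_mx2.
  by rewrite mf_diff_mx2 mx2_0 g1 g2 !mulr0 !addr0 !subrr.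
pose f : even_cocycle (e_mf W_v1) (e_mf W_v2) := exist _ (mx2 p 0 0 t) Ef.
pose g : even_cocycle (e_mf W_v2) (e_mf W_v1) := exist _ (mx2 p' 0 0 t') Eg.
exists f, g; split.
  exists (mx2 0 h' h 0); split; first by apply/homogeneous_mx2.
  rewrite mf_diff_mx2 /= mx2_1 mx2M mx2B !(mul0r, mulr0, addr0, subr0, add0r, oppr0).
  by rewrite gf0 gf1 [in RHS](addrC (u1 * _)).
exists (mx2 0 k' k 0); split; first by apply/homogeneous_mx2.
rewrite mf_diff_mx2 /= mx2_1 mx2M mx2B !(mul0r, mulr0, addr0, subr0, add0r, oppr0).
by rewrite fg0 fg1 [in RHS](addrC (u2 * _)).
Qed.

(** Compared with [isomorphic_hefP] the arguments [v2] and [u2] are exchanged,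
because the shift of e_(v2) is e_(u2) up to sign: the off-diagonal entries of an
odd cocycle, one of them negated, are the diagonal entries of an even one.
The inverse is a cocycle of the total complex, but since [f] is odd the
diagonals of both composites see only its off-diagonal entries. *)
Lemma odd_isomorphic_HEFP :
  odd_isomorphic (e_HEF v1 W_v1) (e_HEF v2 W_v2) <-> inverse_data v1 u1 u2 v2.
Proof.
split.
  move=> [f0 [[f [f_odd f0f]] [g [gf0 f0g]]]].
  (* Being an isomorphism passes to the homogeneous representative f. *)
  have gf : eqmor (compmor (g : @mor (HEF W) _ _) f) (idmor (e_HEF v1 W_v1)).
    apply: eqmor_trans gf0; apply: compmor_eq; first exact: eqmor_refl.
    exact: eqmor_sym.
  have fg : eqmor (compmor (f : @mor (HEF W) _ _) g) (idmor (e_HEF v2 W_v2)).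
    apply: eqmor_trans f0g; apply: compmor_eq; last exact: eqmor_refl.
    exact: eqmor_sym.
  case: f g f_odd gf fg {f0 f0f gf0 f0g} => f df [g dg] /= f_odd [h /= gf] [k /= fg].
  move: f f_odd df g dg h gf k fg => f.
  have [p [q [r [t ->]]]] := mx2_surj f => /homogeneous_mx2[-> ->] df g.
  have [p' [q' [r' [t' ->]]]] := mx2_surj g => dg h.
  have [h00 [h01 [h10 [h11 ->]]]] := mx2_surj h => gf k.
  have [k00 [k01 [k10 [k11 ->]]]] := mx2_surj k => fg.
  move: df; rewrite mf_diff_mx2 mx2_0 => /mx2_inj[df0 _ _ df1].
  move: dg; rewrite mf_diff_mx2 mx2_0 => /mx2_inj[dg0 _ _ dg1].
  move: gf; rewrite mf_diff_mx2 mx2_1 mx2M mx2B !(mul0r, mulr0, addr0, add0r).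
  move=> /mx2_inj[gf0 _ _ gf1].
  move: fg; rewrite mf_diff_mx2 mx2_1 mx2M mx2B !(mul0r, mulr0, addr0, add0r).
  move=> /mx2_inj[fg0 _ _ fg1].
  exists r, (- q), q', (- r'); split.
  - by rewrite !mulrN (addr0_eq df1) -(addr0_eq df0) opprK.
  - by rewrite !mulrN (addr0_eq dg0) -(addr0_eq dg1) opprK.
  - by exists h10, h01; rewrite mulrNN gf0 gf1 addrC.
  by exists k01, k10; rewrite mulrNN fg0 fg1 addrC.
move=> [f0 [f1 [g0 [g1 [[ff ff'] [gg gg'] [h [h' [gf0 gf1]]] [k [k' [fg0 fg1]]]]]]]].
have df : mf_diff (mx2 0 (- f1) f0 0 : Defs.Hom (e_mf W_v1) (e_mf W_v2)) = 0.
  rewrite mf_diff_mx2 mx2_0 !mulr0 !subr0.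
  by congr mx2; rewrite mulrN ?ff ?ff' ?subrr // addrC subrr.
have dg : mf_diff (mx2 0 g0 (- g1) 0 : Defs.Hom (e_mf W_v2) (e_mf W_v1)) = 0.
  rewrite mf_diff_mx2 mx2_0 !mulr0 !subr0.
  by congr mx2; rewrite mulrN ?gg ?gg' ?subrr // addrC subrr.
pose f : cocycle (e_mf W_v1) (e_mf W_v2) := exist _ (mx2 0 (- f1) f0 0) df.
pose g : cocycle (e_mf W_v2) (e_mf W_v1) := exist _ (mx2 0 g0 (- g1) 0) dg.
exists f; split.
  exists f; split; first by apply/homogeneous_mx2.
  exact: cohomologous_refl.
exists g; split.
  exists (mx2 0 h' h 0).
  rewrite mf_diff_mx2 /= mx2_1 mx2M mx2B !(mul0r, mulr0, addr0, subr0, add0r, oppr0).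
  by rewrite gf0 mulrNN gf1 [in RHS](addrC (u1 * _)).
exists (mx2 0 k k' 0).
rewrite mf_diff_mx2 /= mx2_1 mx2M mx2B !(mul0r, mulr0, addr0, subr0, add0r, oppr0).
by rewrite fg0 mulrNN fg1 [in RHS](addrC (v2 * _)).
Qed.

End IsomorphismCriteria.

(** * Comaximality *)

Section Comaximal.
Variable R : comNzRingType.
Implicit Types x y z : R.

Definition comaximal x y : Prop := exists p q, p * x + q * y = 1.

Lemma comaximalC x y : comaximal x y <-> comaximal y x.
Proof. by split=> -[p [q E]]; exists q, p; rewrite addrC. Qed.

Lemma comaximalMr x y z :
  comaximal x (y * z) <-> comaximal x y /\ comaximal x z.
Proof.
split=> [[p [q E]] | [[p [q E]] [p' [q' E']]]].
  by split; [exists p, (q * z) | exists p, (q * y)]; rewrite -E; ring.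
exists (p * p' * x + p * q' * z + q * y * p'), (q * q').
have -> : 1 = (p * x + q * y) * (p' * x + q' * z) by rewrite E E' mulr1.
ring.
Qed.

Lemma comaximalMl x y z :
  comaximal (x * y) z <-> comaximal x z /\ comaximal y z.
Proof. by rewrite !(comaximalC _ z) comaximalMr. Qed.

End Comaximal.

(** * Inverse pairs for coprime cofactors *)

Section EvenCase.
Variable R : idomainType.
Implicit Types a b c d s : R.

(** Here [a] and [d] are the coprime cofactors of [s], so that the pair
(v1, u1) is (s a b, s c d) and (v2, u2) is (s a c, s b d).  Exchanging (b, c)
with (a, d) turns (v2, u2) into (s b d, s a c), that is (u2, v2); this is how
the lemma also settles odd isomorphisms. *)
Lemma inverse_data_comaximal s a b c d : s * a != 0 ->
  comaximal b c -> comaximal a d ->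
  inverse_data (s * a * b) (c * s * d) (s * a * c) (b * s * d) <->
  [/\ comaximal a b, comaximal a c, comaximal d b, comaximal d c
    & comaximal (b * c) s].
Proof.
move=> sa_neq0 bc ad; split.
  move=> [f0 [f1 [g0 [g1 [[ff _] [gg _] [h [k [gf _]]] [h' [k' [fg _]]]]]]]].
  have cf : c * f1 = b * f0.
    by apply: (mulfI sa_neq0); rewrite !mulrA.
  have bg : b * g1 = c * g0.
    by apply: (mulfI sa_neq0); rewrite !mulrA.
  have [m [n E]] := bc.
  (* The quotients f0 / c and g0 / b, obtained from m * b + n * c = 1. *)
  pose t := m * f1 + n * f0; pose t' := m * g0 + n * g1.
  have Ef : f0 = c * t by rewrite -[LHS]mul1r -E /t; ring: cf.
  have Eg : g0 = b * t' by rewrite -[LHS]mul1r -E /t'; ring: bg.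
  rewrite Eg Ef in gf fg.
  (* Both homotopy equations are solved for 1. *)
  have {}gf := etrans (esym (subKr _ _)) (congr1 (fun x => b * t' * (c * t) - x) gf).
  have {}fg := etrans (esym (subKr _ _)) (congr1 (fun x => c * t * (b * t') - x) fg).
  have /comaximalMr[/comaximalMr[_ sb] db] : comaximal b (c * s * d).
    by exists (c * t * t' - s * a * h), (- k); rewrite [RHS]gf; ring.
  have /comaximalMr[/comaximalMr[sc ac] _] : comaximal c (s * a * b).
    by exists (b * t * t' - s * d * k), (- h); rewrite [RHS]gf; ring.
  have /comaximalMr[/comaximalMr[_ ab] _] : comaximal b (s * a * c).
    by exists (c * t * t' - s * d * k'), (- h'); rewrite [RHS]fg; ring.
  have /comaximalMr[_ dc] : comaximal c (b * s * d).
    by exists (b * t * t' - s * a * h'), (- k'); rewrite [RHS]fg; ring.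
  by split; [apply/comaximalC..|apply/comaximalMl].
move=> [ab ac db dc [t [y E]]].
(* Thus s is a combination of s * a * b and s * c * d, and similarly below. *)
have [p [q Es]] : comaximal (a * b) (c * d).
  by rewrite comaximalMr !comaximalMl; split; split=> //; apply/comaximalC.
have [p' [q' Es']] : comaximal (a * c) (b * d).
  rewrite comaximalMr !comaximalMl; split; split=> //; exact/comaximalC.
(* diag(c, b) generates the cocycles; t inverts b * c modulo s. *)
exists c, b, (t * b), (t * c).
have E0 : t * b * c - 1 = - y * s by rewrite -E; ring.
split; try by split; ring.
  exists (- y * p), (- y * q); rewrite (mulrAC t c) E0 -[s in LHS]mulr1 -Es.
  by split; ring.
exists (- y * p'), (- y * q').
rewrite (mulrC c) (mulrC b (t * c)) (mulrAC t c) E0 -[s in LHS]mulr1 -Es'.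
by split; ring.
Qed.

End EvenCase.

(** * Greatest common divisors in a Bezout domain *)

Section Bezout.
Variables (R : idomainType) (bezoutR : bezout_domain R).

(** A generator of the ideal (x, y) is a common divisor of [x] and [y], so it
divides [g], which puts [g] into that ideal. *)
Lemma is_gcd_combination (g x y : R) : is_gcd g x y ->
  exists p q, g = p * x + q * y.
Proof.
move=> [_ _ g_max].
have [e eP] := bezoutR (fun i : 'I_2 => if i == ord0 then x else y).
have sumE (k : 'I_2 -> R) :
    \sum_i k i * (if i == ord0 then x else y) = k ord0 * x + k ord_max * y.
  by rewrite big_ord_recl big_ord1 /=; congr (_ + k _ * _); apply: val_inj.
have ex : divides e x.
  apply/eP; exists (fun i => (i == ord0)%:R).
  by rewrite sumE /= mul1r mul0r addr0.
have ey : divides e y.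
  apply/eP; exists (fun i => (i != ord0)%:R).
  by rewrite sumE /= mul1r mul0r add0r.
have /eP[k ->] := g_max e ex ey.
by exists (k ord0), (k ord_max).
Qed.

Lemma are_coprimeP (x y : R) : are_coprime x y <-> comaximal x y.
Proof.
split=> [/is_gcd_combination[p [q E]] | [p [q E]]]; first by exists p, q.
split; [by exists x; rewrite mulr1 | by exists y; rewrite mulr1 |].
by move=> h [k kx] [l ly]; exists (p * k + q * l); rewrite -E kx ly; ring.
Qed.

Lemma gcd_cofactors_comaximal (g x y : R) :
  g != 0 -> is_gcd g (g * x) (g * y) -> comaximal x y.
Proof.
move=> g_neq0 /is_gcd_combination[p [q E]]; exists p, q.
by apply: (mulfI g_neq0); rewrite mulr1 [RHS]E; ring.
Qed.

Lemma pairwise_coprime4 (x y z t : R) : pairwise_coprime [:: x; y; z; t] <->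
  [/\ comaximal x y, comaximal x z & comaximal x t] /\
  [/\ comaximal y z, comaximal y t & comaximal z t].
Proof.
split=> [H | [[? ? ?] [? ? ?]]].
  split; split; apply/are_coprimeP.
  - exact: (H 0 1).
  - exact: (H 0 2).
  - exact: (H 0 3).
  - exact: (H 1 2).
  - exact: (H 1 3).
  - exact: (H 2 3).
case=> [|[|[|i]]] [|[|[|[|j]]]] //=; try by move=> _; apply/are_coprimeP.
by rewrite !ltnS ltn0 andbF.
Qed.

End Bezout.

Theorem proposition2p4 (R : idomainType) (W v1 v2 u1 u2 a b c d s a' d' : R)
    (bezoutR : bezout_domain R) (W_neq0 : W != 0)
    (W_v1 : W = v1 * u1) (W_v2 : W = v2 * u2)
    (a_gcd : is_gcd a v1 v2)
    (v1_b : v1 = a * b) (v2_c : v2 = a * c) (W_d : W = a * b * c * d)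
    (s_gcd : is_gcd s a d)
    (a_a' : a = s * a') (d_d' : d = s * d') :
  (isomorphic (e_hef v1 W_v1) (e_hef v2 W_v2) <->
     pairwise_coprime [:: a'; b; c; d'] /\ are_coprime (b * c) s) /\
  (odd_isomorphic (e_HEF v1 W_v1) (e_HEF v2 W_v2) <->
     pairwise_coprime [:: a'; b; c; d'] /\ are_coprime (a' * d') s).
Proof.
rewrite isomorphic_hefP odd_isomorphic_HEFP.
rewrite !are_coprimeP // pairwise_coprime4 //.
have := W_neq0; rewrite W_d !mulf_eq0 !negb_or -!andbA.
case/and4P=> a_neq0 b_neq0 c_neq0 _.
have u1E : u1 = c * d.
  by apply: (mulfI (mulf_neq0 a_neq0 b_neq0)); rewrite mulrA -W_d W_v1 v1_b.
have u2E : u2 = b * d.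
  apply: (mulfI (mulf_neq0 a_neq0 c_neq0)).
  by rewrite [RHS]mulrACA mulrA -W_d W_v2 v2_c.
have bc : comaximal b c.
  by apply: (gcd_cofactors_comaximal bezoutR a_neq0); rewrite -v1_b -v2_c.
have s_neq0 : s != 0 by apply: contraNneq a_neq0 => s0; rewrite a_a' s0 mul0r.
have ad : comaximal a' d'.
  by apply: (gcd_cofactors_comaximal bezoutR s_neq0); rewrite -a_a' -d_d'.
have sa_neq0 : s * a' != 0 by rewrite -a_a'.
have sb_neq0 : s * b != 0 by rewrite mulf_neq0.
have even := inverse_data_comaximal sa_neq0 bc ad.
have odd := inverse_data_comaximal sb_neq0 ad bc.
split.
  rewrite v1_b v2_c u1E u2E a_a' d_d' !mulrA even.
  by split=> [[? ? /comaximalC ? /comaximalC ? ?] | [[[? ? _] [_ ? ?]] ?]];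
    repeat split=> //; apply/comaximalC.
have -> : v1 = s * b * a' by rewrite v1_b a_a'; ring.
have -> : v2 = a' * s * c by rewrite v2_c a_a'; ring.
have -> : u1 = d' * s * c by rewrite u1E d_d'; ring.
have -> : u2 = s * b * d' by rewrite u2E d_d'; ring.
rewrite odd.
by split=> [[/comaximalC ? ? /comaximalC ? ? ?] | [[[? ? _] [_ ? ?]] ?]];
  repeat split=> //; apply/comaximalC.
Qed.
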